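(* Let $f:E\to\mathbb{R}$ be an $L$-smooth convex function ($L>0$), let $\varphi:C\to\mathbb{R}$ be a lower semicontinuous $\sigma$-strongly convex function ($\sigma>0$), and let $x^*$ be a minimizer of $f$ over $C$. Let $s>0$, let $x_0$ be the minimizer of $\varphi$ over $C$, and let $\{x_k\}_{k\ge0}$, $\{y_k\}_{k\ge1}$, $\{z_k\}_{k\ge1}$ be sequences in $C$ satisfying, for all $k\ge0$, $$y_{k+1}\in\mathop{\arg\min}_{y\in C}\left\{s\langle\nabla f(x_k),y-x_k\rangle+\frac12\|y-x_k\|^2\right\},$$ $$z_{k+1}=\mathop{\arg\min}_{z\in C}\left\{\frac{1}{\sigma s}\varphi(z)+\sum_{i=0}^{k}\frac{i+1}{2}[f(x_i)+\langle\nabla f(x_i),z-x_i\rangle]\right\},$$ $$x_{k+1}=\frac{2}{k+3}z_{k+1}+\frac{k+1}{k+3}y_{k+1}.$$ If $0<s\le\frac1L$, then for all $k\ge1$ $$f(y_k)-f(x^* )\le\frac{4D_\varphi(x^*,x_0)}{k(k+1)\sigma s},$$ where $D_\varphi(x^*,x_0)=\varphi(x^* )-\varphi(x_0)$ is the Bregman divergence taken with the subgradient $0\in\partial\varphi(x_0)$. If in addition $0<s<\frac1L$, then, as $k\to\infty$, $$\min_{0\le i\le k}\|y_{i+1}-x_i\|^2=o\left(\frac{1}{k^3}\right).$$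
   Context: $E$ is a finite-dimensional real vector space with norm $\|\cdot\|$, $E^*$ its dual with dual norm $\|\cdot\|_*$, and $\langle s,x\rangle$ denotes the value of $s\in E^*$ at $x\in E$. $C\subseteq E$ is a nonempty closed convex set. $f$ is $L$-smooth convex if it is convex, differentiable and $\|\nabla f(x)-\nabla f(y)\|_*\le L\|x-y\|$ for all $x,y$. $\varphi$ is extended by $+\infty$ outside $C$ (lower semicontinuity and the subdifferential refer to this extension). It is $\sigma$-strongly convex if it is convex and $\varphi(y)-\varphi(x)-\langle g,y-x\rangle\ge\frac{\sigma}{2}\|y-x\|^2$ for all $x,y\in C$ and $g\in\partial\varphi(x)$. The Bregman divergence is $D_\varphi(y,x)=\varphi(y)-\varphi(x)-\langle\varphi'(x),y-x\rangle$ for a selected $\varphi'(x)\in\partial\varphi(x)$. *)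

(* Defs.v *)
From HB Require Import structures.
From mathcomp Require Import all_boot all_order all_algebra.
From mathcomp Require Import all_classical all_reals all_analysis.
Set Implicit Arguments.
Unset Strict Implicit.
Unset Printing Implicit Defensive.
Import Order.TTheory GRing.Theory Num.Theory.
Import numFieldNormedType.Exports.
Local Open Scope classical_set_scope.
Local Open Scope ring_scope.

(* Elements of the dual space are taken to be all linear forms: on a
   finite-dimensional normed space they are automatically continuous. *)
Definition dual_norm (R : realType) (E : normedModType R)
    (g : {linear E -> R^o}) : R :=
  sup [set `|g v| | v in [set v : E | `|v| <= 1]].

Definition argmin (R : realType) (E : normedModType R) (C : set E)
    (F : E -> R) : set E :=
  [set x | C x /\ forall y, C y -> F x <= F y].

Definition smooth_convex (R : realType) (E : normedModType R) (L : R)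
    (f : E -> R) : Prop :=
  [/\ convex_function setT f,
      (forall x, differentiable f x) &
      forall x y, dual_norm ('d f x \- 'd f y) <= L * `|x - y|].

(* A function phi : C -> R is represented by a total function on E of which
   only the values on C are used. *)
Definition extend (R : realType) (E : normedModType R) (C : set E)
    (phi : E -> R) : E -> \bar R :=
  patch (cst +oo%E) C (EFin \o phi).

Definition subdifferential (R : realType) (E : normedModType R)
    (h : E -> \bar R) (x : E) : set {linear E -> R^o} :=
  [set g | h x \is a fin_num /\
           forall y, (h x + (g (y - x))%:E <= h y)%E].

Definition strongly_convex (R : realType) (E : normedModType R) (sigma : R)
    (C : set E) (phi : E -> R) : Prop :=
  convex_function C phi /\
  forall x y (g : {linear E -> R^o}), C x -> C y ->
    subdifferential (extend C phi) x g ->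
    sigma / 2 * `|y - x| ^+ 2 <= phi y - phi x - g (y - x).

(* [g] is the selected subgradient phi'(x), a member of the subdifferential
   of [extend C phi] at x. *)
Definition bregman (R : realType) (E : normedModType R) (phi : E -> R)
    (g : {linear E -> R^o}) (y x : E) : R :=
  phi y - phi x - g (y - x).

Lemma argmin_subdifferential0 (R : realType) (E : normedModType R)
    (C : set E) (phi : E -> R) (x : E) :
  argmin C phi x -> subdifferential (extend C phi) x \0.
Proof.
move=> [Cx xmin]; rewrite /subdifferential /extend /= /patch mem_set//=.
split=> // y; rewrite adde0; case: ifPn => [/set_mem Cy|_].
  by rewrite lee_fin xmin.
by rewrite leey.
Qed.

Lemma bregman0 (R : realType) (E : normedModType R) (phi : E -> R) (y x : E) :
  bregman phi \0 y x = phi y - phi x.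
Proof. by rewrite /bregman /= subr0. Qed.

(* Main.v *)
(* Write Psi_k(v) = (phi(v) - phi(x_0)) / (sigma s)
     + sum_{i<k} (i+1)/2 [f(x_i) + <f'(x_i), v - x_i>]
   and A_k = k(k+1)/4, the sum of the weights. Psi_k grows quadratically, with
   constant 1/(2s), around its minimiser z_k. Combined with the descent lemma
   and the minimality of y_{k+1}, induction on k gives Nesterov's
   estimate-sequence inequality in the sharp form
     A_k f(y_k) + sum_{i<k} A_{i+1} (1/s - L)/2 |y_{i+1} - x_i|^2
       <= min_C Psi_k.
   Since Psi_k(x^* ) <= D/(sigma s) + A_k f(x^* ), dropping the sum yields the
   rate on f(y_k). Keeping it when s < 1/L shows that the series
   sum_i i^2 |y_{i+1} - x_i|^2 converges, and the smallness of its tail over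
   k/2 <= i <= k forces the o(1/k^3) bound on the minimum. *)
From HB Require Import structures.
Require Import Defs.
From mathcomp Require Import all_boot all_order all_algebra.
From mathcomp Require Import all_classical all_reals all_analysis.
From mathcomp Require Import ring lra zify.
Import Order.TTheory GRing.Theory Num.Theory.
Import numFieldNormedType.Exports.
Local Open Scope classical_set_scope.
Local Open Scope ring_scope.

Set Implicit Arguments.
Unset Strict Implicit.

(** * The dual norm and first-order inequalities for smooth convex functions *)

(** Continuity bounds the set whose [sup] defines [dual_norm g], so the supremum is a true upper
    bound; scaling [v] to norm one does the rest. *)
Lemma dual_norm_le (R : realType) (E : normedModType R)
    (g : {linear E -> R^o}) (v : E) :
  continuous g -> `|g v| <= dual_norm g * `|v|.
Proof.
move=> /(linear_bounded_continuous g)/linear_boundedP [M [_ Mb]].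
have bnd : has_ubound [set `|g v| | v in [set v : E | `|v| <= 1]].
  exists (`|M| + 1) => _ [w /= w1 <-].
  have /Mb/(_ w)/le_trans : M < `|M| + 1.
    by rewrite (le_lt_trans (ler_norm M))// ltrDl.
  by apply; rewrite ler_piMr// addr_ge0.
have [->|v0] := eqVneq v 0; first by rewrite linear0 !normr0 mulr0.
have nv : 0 < `|v| by rewrite normr_gt0.
rewrite -ler_pdivrMr//.
have -> : `|g v| / `|v| = `|g (`|v|^-1 *: v)|.
  by rewrite linearZ /= normrM mulrC ger0_norm.
apply: ub_le_sup => //=; exists (`|v|^-1 *: v) => //=.
by rewrite normrZ ger0_norm// mulVf ?gt_eqF.
Qed.

Lemma smooth_convex_lipschitz (R : realType) (E : normedModType R) (L : R)
    (f : E -> R) (x y v : E) :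
  smooth_convex L f -> 'd f x v - 'd f y v <= L * `|x - y| * `|v|.
Proof.
move=> [_ df Lf]; apply: le_trans (ler_norm _) _.
apply: le_trans (ler_wpM2r (normr_ge0 _) (Lf x y)).
apply: (@dual_norm_le R E ('d f x \- 'd f y)).
move=> w; apply: cvgB; exact: diff_continuous.
Qed.

(** Convexity bounds the difference quotients of [f] at [x] along [y - x], for steps in (0, 1], by
    [f y - f x]; let the step decrease to 0. *)
Lemma convex_diff_le (R : realType) (E : normedModType R) (f : E -> R)
    (x y : E) :
  convex_function setT f -> differentiable f x -> f x + 'd f x (y - x) <= f y.
Proof.
move=> cvxf df; rewrite addrC -lerBrDr -deriveE//.
have /cvg_dnbhs_at_right cv := @diff_derivable _ _ _ f x (y - x) df.
rewrite /derive cvg_at_rightE; last exact: diff_derivable.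
apply: limr_le; first by apply: cvgP cv.
near=> h.
have h0 : 0 < h by near: h; exact: nbhs_right_gt.
have h1 : h <= 1 by near: h; exact: nbhs_right_le.
rewrite /= ler_pdivrMl//.
have cf : f (h *: (y - x) + x) <= h * f y + (1 - h) * f x.
  have -> : h *: (y - x) + x = h *: y + (1 - h) *: x.
    by rewrite scalerBr scalerBl scale1r addrA addrAC.
  exact: (cvxf (Itv01 (ltW h0) h1) y x (in_setT _) (in_setT _)).
rewrite lerBlDr; apply: le_trans cf _.
rewrite /GRing.scale/=; lra.
Unshelve. all: by end_near.
Qed.

Lemma is_derive_line (R : realType) (E : normedModType R) (f : E -> R)
    (x d : E) (t : R) :
  differentiable f (x + t *: d) ->
  is_derive t 1 (fun u : R => f (x + u *: d)) ('d f (x + t *: d) d).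
Proof.
move=> df.
have eqf : (fun h : R => h^-1 *: (((fun u : R => f (x + u *: d)) \o shift t)
      (h *: 1) - f (x + t *: d))) =
    (fun h => h^-1 *: ((f \o shift (x + t *: d)) (h *: d) - f (x + t *: d))).
  apply/funext => h /=; congr (_ *: (f _ - _)).
  by rewrite (_ : h *: 1 = h) ?scalerDl 1?addrCA//; exact: mulr1.
apply: DeriveDef; first by rewrite /derivable eqf; exact: diff_derivable.
by rewrite -deriveE// /derive eqf.
Qed.

Lemma smooth_convex_descent (R : realType) (E : normedModType R) (L : R)
    (f : E -> R) (x y : E) :
  smooth_convex L f ->
  f y <= f x + 'd f x (y - x) + L / 2 * `|y - x| ^+ 2.
Proof.
move=> sf; have [_ df _] := sf.
set d := y - x.
(* The claim is [g 1 <= g 0]. The Lipschitz bound makes [dg] nonpositive on [0, 1], and the mean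
   value theorem stands in for the usual integral. *)
pose g := fun u : R =>
  f (x + u *: d) - u * 'd f x d - u ^+ 2 * (L / 2 * `|d| ^+ 2).
pose dg := fun u : R =>
  'd f (x + u *: d) d - 'd f x d - u * (L * `|d| ^+ 2).
have gd (u : R) : is_derive u 1 g (dg u).
  have := is_derive_line (df (x + u *: d)) => h1.
  apply: is_derive_eq.
  rewrite /dg /GRing.scale/=; lra.
have [|c /andP[c0 c1] gc] := @MVT_segment R g dg 0 1 ler01 (fun u _ => gd u).
  apply: continuous_subspaceT => u; apply: differentiable_continuous.
  by apply/derivable1_diffP; apply: (@ex_derive _ _ _ _ _ _ _ (gd u)).
have := smooth_convex_lipschitz (x + c *: d) x d sf.
rewrite addrAC subrr add0r normrZ ger0_norm// => H.
have : g 1 - g 0 <= 0.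
  rewrite gc subr0 mulr1 /dg; lra.
rewrite /g scale1r scale0r addr0 addrCA subrr addr0; lra.
Qed.

(** * Quadratic growth around a minimiser *)

Lemma argmin_strongly_convex (R : realType) (E : normedModType R) (sigma : R)
    (C : set E) (phi : E -> R) (g : {linear E -> R^o}) (z w : E) :
  strongly_convex sigma C phi -> argmin C (fun v => phi v + g v) z -> C w ->
  phi z + g z + sigma / 2 * `|w - z| ^+ 2 <= phi w + g w.
Proof.
(* - g is itself a subgradient of phi at z, so no sum rule is needed. *)
move=> [_ scphi] [Cz zmin] Cw.
have := scphi z w (\- g) Cz Cw; rewrite /= linearB/= => sc.
suff /sc : subdifferential (extend C phi) z (\- g) by lra.
rewrite /subdifferential /extend /= /patch mem_set//=; split=> // v.
case: ifPn => [/set_mem Cv|_]; last by rewrite leey.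
rewrite -EFinD lee_fin linearB/=; have := zmin v Cv; lra.
Qed.

(** * From a bounded weighted series to a little-o bound on minima *)

(** The default [u 0] of the iterated minimum is one of its terms, so it does not change the
    value. *)
Lemma min_littleo_cube (R : realType) (u : nat -> R) (M : R) :
  (forall i, 0 <= u i) ->
  (forall k, \sum_(0 <= i < k) i.+1%:R ^+ 2 * u i <= M) ->
  (fun k : nat => \big[Num.min/u 0%N]_(0 <= i < k.+1) u i)
    =o_\oo (fun k : nat => (k%:R ^+ 3)^-1 : R).
Proof.
move=> u0 uM; apply/eqoP => eps eps0.
pose S k := \sum_(0 <= i < k) i.+1%:R ^+ 2 * u i.
have Snd : {homo S : n m / (n <= m)%N >-> n <= m}.
  apply/nondecreasing_seqP => k.
  by rewrite /S big_nat_recr//= lerDl mulr_ge0.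
have Scv : cvgn S.
  by apply: nondecreasing_is_cvgn => //; exists M => _ [k _ <-]; exact: uM.
(* The 8 compensates the factor in (k/2)^3 = k^3/8. *)
have e8 : 0 < eps / 8 by rewrite divr_gt0.
have [N _ SN] := (cvgrPdist_le S (limn S)).1 Scv _ e8.
(* This threshold ensures both [N <= k./2] and [0 < k]. *)
exists N.*2.+1 => // k /= kN.
set m := \big[_/_]_(_ <- _) _.
have m0 : 0 <= m by apply: le_bigmin.
have mle i : (i < k.+1)%N -> m <= u i.
  move=> ik; rewrite /m big_mkord.
  exact: (@bigmin_le _ _ 'I_k.+1 (u 0%N) (Ordinal ik) (fun j : 'I_k.+1 => u j)).
have k0 : 0 < k%:R :> R by rewrite ltr0n; case: k kN {m m0 mle}.
have k3 : 0 < k%:R ^+ 3 :> R by rewrite exprn_gt0.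
rewrite (ger0_norm m0) ger0_norm ?invr_ge0 ?(ltW k3)// ler_pdivlMr//.
(* The indices between k/2 and k contribute at least m (k/2)^3. *)
have Nh : (N <= k./2)%N by lia.
have tail : \sum_(k./2 <= i < k.+1) i.+1%:R ^+ 2 * u i <= eps / 8.
  have := SN _ Nh => /=; have := nondecreasing_cvgn_le Snd Scv k.+1.
  rewrite ger0_norm; last first.
    by rewrite subr_ge0; exact: nondecreasing_cvgn_le.
  have -> : S k.+1 = S k./2 + \sum_(k./2 <= i < k.+1) i.+1%:R ^+ 2 * u i.
    by rewrite /S -big_cat_nat//=; lia.
  lra.
have : \sum_(k./2 <= i < k.+1) (k%:R / 2) ^+ 2 * m <=
    \sum_(k./2 <= i < k.+1) i.+1%:R ^+ 2 * u i.
  rewrite !big_nat; apply: ler_sum => i /andP[ki ik].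
  apply: ler_pM (mle i ik) => //.
  (* The shift in the weight [i.+1] absorbs the rounding in [k./2]: k <= 2(i+1) also for odd k. *)
  rewrite ler_sqr ?nnegrE ?divr_ge0// ler_pdivrMr// -natrM ler_nat.
  rewrite -[X in (X <= _)%N]odd_double_half muln2; lia.
rewrite sumr_const_nat -[_ *+ _]mulr_natl => low.
(* The number of indices supplies the third factor k/2. *)
have kk : k%:R / 2 <= (k.+1 - k./2)%:R :> R.
  rewrite ler_pdivrMr// -natrM ler_nat; lia.
have := ler_wpM2r (mulr_ge0 (sqr_ge0 (k%:R / 2)) m0) kk.
rewrite [X in m * X]exprS expr2 in k3 *.
rewrite [in X in X -> _]expr2 in low *; nra.
Qed.

(** * The estimate-sequence inequality *)

Lemma accelerated_energy (R : realType) (E : normedModType R)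
    (C : set E) (cvxC : convex_set C)
    (f : E -> R) (L : R) (smooth_f : smooth_convex L f)
    (phi : E -> R) (sigma : R) (sigma_gt0 : 0 < sigma)
    (sc_phi : strongly_convex sigma C phi)
    (s : R) (s_gt0 : 0 < s)
    (x y z : nat -> E)
    (x0_min : argmin C phi (x 0%N))
    (xyzC : forall k, [/\ C (x k), C (y k.+1) & C (z k.+1)])
    (y_min : forall k,
      argmin C (fun v => s * 'd f (x k) (v - x k) + 2^-1 * `|v - x k| ^+ 2)
        (y k.+1))
    (z_min : forall k,
      argmin C (fun v => (sigma * s)^-1 * phi v +
          \sum_(0 <= i < k.+1)
            i.+1%:R / 2 * (f (x i) + 'd f (x i) (v - x i)))
        (z k.+1))
    (x_step : forall k, x k.+1 =
      (2 / (k + 3)%:R) *: z k.+1 + (k.+1%:R / (k + 3)%:R) *: y k.+1)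
    (k : nat) (w : E) : C w ->
  k%:R * k.+1%:R / 4 * f (y k) +
    \sum_(0 <= i < k) i.+1%:R * i.+2%:R / 4 * ((s^-1 - L) / 2) *
      `|y i.+1 - x i| ^+ 2 <=
  (sigma * s)^-1 * (phi w - phi (x 0%N)) + k%:R * k.+1%:R / 4 * f w.
Proof.
have [cvxf df _] := smooth_f.
have ss0 : 0 < sigma * s by rewrite mulr_gt0.
(* z_k minimises Psi_k over C for every k, with z_0 := x_0. *)
pose Psi k v := (sigma * s)^-1 * (phi v - phi (x 0%N)) +
  \sum_(0 <= i < k) i.+1%:R / 2 * (f (x i) + 'd f (x i) (v - x i)).
pose zeta k := if k is _.+1 then z k else x 0%N.
have zeta_min j : argmin C (Psi j) (zeta j).
  case: j => [|j] /=.
    have [Cx xm] := x0_min; split=> // v Cv; rewrite /Psi !big_nil !addr0.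
    by rewrite ler_pM2l ?invr_gt0// lerD2r xm.
  have [Cz zm] := z_min j; split=> // v Cv; rewrite /Psi.
  have := zm v Cv; lra.
have Psi_growth j v : C v ->
    Psi j (zeta j) + (2 * s)^-1 * `|v - zeta j| ^+ 2 <= Psi j v.
  move=> Cv.
  (* Up to a constant, [Psi j] is [phi] plus a linear form, divided by [sigma * s]; this turns the
     growth constant sigma/2 into 1/(2s). *)
  pose l u : R^o := sigma * s * \sum_(0 <= i < j) i.+1%:R / 2 * 'd f (x i) u.
  have lin_l : linear l.
    move=> a u u'; rewrite /l scalerAr -mulrDr scaler_sumr -big_split/=.
    congr (_ * _); apply: eq_bigr => i _; rewrite linearP /GRing.scale/=; ring.
  pose g : {linear E -> R^o} :=
    HB.pack l (GRing.isLinear.Build _ _ _ _ l lin_l).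
  pose c := \sum_(0 <= i < j) i.+1%:R / 2 * (f (x i) - 'd f (x i) (x i)).
  have PsiE u : Psi j u =
      (sigma * s)^-1 * (phi u + g u) - (sigma * s)^-1 * phi (x 0%N) + c.
    rewrite mulrDr /g/= /l mulKf ?gt_eqF// /Psi mulrBr.
    have -> : \sum_(0 <= i < j) i.+1%:R / 2 * (f (x i) + 'd f (x i) (u - x i)) =
        \sum_(0 <= i < j) i.+1%:R / 2 * 'd f (x i) u + c.
      rewrite /c -big_split/=; apply: eq_bigr => i _; rewrite linearB/=; ring.
    ring.
  have zmin : argmin C (fun u => phi u + g u) (zeta j).
    have [Cz zm] := zeta_min j; split=> // u Cu.
    have := zm u Cu; by rewrite !PsiE lerD2r lerD2r ler_pM2l ?invr_gt0.
  have := argmin_strongly_convex sc_phi zmin Cv.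
  rewrite -(ler_pM2l (_ : 0 < (sigma * s)^-1)) ?invr_gt0// !PsiE.
  have -> : (2 * s)^-1 = (sigma * s)^-1 * (sigma / 2).
    by field; rewrite !gt_eqF.
  lra.
suff : k%:R * k.+1%:R / 4 * f (y k) +
    \sum_(0 <= i < k) i.+1%:R * i.+2%:R / 4 * ((s^-1 - L) / 2) *
      `|y i.+1 - x i| ^+ 2 <= Psi k (zeta k).
  move=> H Cw; apply: le_trans H _; apply: le_trans ((zeta_min k).2 w Cw) _.
  rewrite /Psi lerD2l.
  have -> : k%:R * k.+1%:R / 4 = \sum_(0 <= i < k) i.+1%:R / 2 :> R.
    elim: (k) => [|j IH]; first by rewrite big_nil !mul0r.
    by rewrite big_nat_recr//= -IH -!natr1; field.
  rewrite mulr_suml; apply: ler_sum => i _.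
  by rewrite ler_wpM2l ?divr_ge0// convex_diff_le.
elim: (k) => [|j IH].
  by rewrite /Psi !big_nil /= subrr mulr0 !mul0r.
rewrite big_nat_recr//=.
have -> : Psi j.+1 (z j.+1) = Psi j (z j.+1) +
    j.+1%:R / 2 * (f (x j) + 'd f (x j) (z j.+1 - x j)).
  by rewrite /Psi big_nat_recr//= addrA.
have [Cx Cy Cz] := xyzC j.
have := Psi_growth j _ Cz.
pose t : R := 2 / j.+2%:R.
have j2 : 0 < j.+2%:R :> R by rewrite ltr0n.
have t0 : 0 <= t by rewrite divr_ge0.
have t1 : t <= 1 by rewrite ler_pdivrMr// mul1r ler_nat.
(* For j = 0 one has t = 1, so the unconstrained value [y 0] drops out, here and in [q] below. *)
have xE : x j = t *: zeta j + (1 - t) *: y j.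
  rewrite /t; case: j {IH Cx Cy Cz j2 t0 t1 t} => [|j] /=.
    by rewrite divff ?pnatr_eq0// subrr scale0r addr0 scale1r.
  rewrite x_step addn3; congr (_ *: _ + _ *: _).
  have j3 : j.+3%:R != 0 :> R by rewrite pnatr_eq0.
  by apply: (mulIf j3); rewrite mulrBl mul1r !mulfVK// -natrB// subn2.
(* q differs from x_j only by replacing z_j with z_{j+1}; being in C, it is a
   competitor of y_{j+1}. *)
pose q := t *: z j.+1 + (1 - t) *: y j.
have Cq : C q.
  move: t1; rewrite /q /t; case: j {IH Cx Cy j2 t0 xE q t} Cz => [|j] Cz t1.
    by rewrite divff ?pnatr_eq0// subrr scale0r addr0 scale1r.
  have [_ Cy _] := xyzC j.
  have t0 : 0 <= 2 / j.+3%:R :> R by rewrite divr_ge0.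
  have := cvxC (z j.+2) (y j.+1) (Itv01 t0 t1) (mem_set Cz) (mem_set Cy).
  by move/set_mem.
have qx : q - x j = t *: (z j.+1 - zeta j).
  by rewrite xE /q opprD addrACA subrr addr0 scalerBr.
have dq : 'd f (x j) (q - x j) =
    t * 'd f (x j) (z j.+1 - x j) + (1 - t) * 'd f (x j) (y j - x j).
  have -> : q - x j = t *: (z j.+1 - x j) + (1 - t) *: (y j - x j).
    by rewrite !scalerBr addrACA -opprD -scalerDl [t + _]addrC subrK scale1r.
  by rewrite linearP linearZ.
have := (y_min j).2 q Cq.
rewrite /= dq qx normrZ (ger0_norm t0) => step.
have descent := smooth_convex_descent (x j) (y j.+1) smooth_f.
have grad := convex_diff_le (y j) cvxf (df (x j)).
(* [B] and [A] are A_{j+1} and A_j. The choice of t gives B t = (j+1)/2, the new weight, and B t^2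
   <= 1, so the growth of [Psi j] pays for the quadratic term at [q]. *)
set B := j.+1%:R * j.+2%:R / 4 : R.
set A := j%:R * j.+1%:R / 4 : R in IH *.
have B0 : 0 <= B by rewrite divr_ge0// mulr_ge0.
have A0 : 0 <= A by rewrite divr_ge0// mulr_ge0.
have j2' : 2 + j%:R != 0 :> R by rewrite -natrD pnatr_eq0.
have Bt : B * t = j.+1%:R / 2.
  by rewrite /B /t -!natr1; field; rewrite ?j2'//.
have BA : B * (1 - t) = A by rewrite mulrBr mulr1 Bt /B /A -!natr1; field.
have Bt2 : B * t ^+ 2 <= 1.
  rewrite expr2 mulrA Bt /t mulrA divfK ?pnatr_eq0//.
  by rewrite ler_pdivrMr// mul1r ler_nat.
have sV0 : 0 < s^-1 by rewrite invr_gt0.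
have {step} : B * t * 'd f (x j) (z j.+1 - x j) +
    B * (1 - t) * 'd f (x j) (y j - x j) +
    (2 * s)^-1 * `|z j.+1 - zeta j| ^+ 2 >=
    B * 'd f (x j) (y j.+1 - x j) + B * (s^-1 / 2 * `|y j.+1 - x j| ^+ 2).
  (* Minimality of [y j.+1] against [q] is scaled by B/s. *)
  have := ler_wpM2l (mulr_ge0 B0 (ltW sV0)) step.
  have : (2 * s)^-1 * (B * t ^+ 2 * `|z j.+1 - zeta j| ^+ 2) <=
      (2 * s)^-1 * (1 * `|z j.+1 - zeta j| ^+ 2).
    by rewrite ler_wpM2l ?ler_wpM2r ?sqr_ge0// invr_ge0 mulr_ge0// ltW.
  rewrite [(t * _) ^+ 2]exprMn invfM ![B * s^-1 * (_ + _)]mulrDr.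
  rewrite ![B * s^-1 * (s * _)]mulrA.
  rewrite mulfVK ?gt_eqF//; lra.
rewrite Bt BA => step growth.
(* Since B = A + (j+1)/2, the term B f(x_j) from the descent lemma splits: the A part is bounded
   through f(y_j), the rest joins the new linearisation. *)
have := ler_wpM2l A0 grad; have := ler_wpM2l B0 descent.
have BAt : B = A + j.+1%:R / 2 by rewrite -BA -Bt mulrBr mulr1 subrK.
move: IH step growth.
set S := \sum_(_ <= _ < _) _; rewrite BAt; lra.
Qed.

(** * The two convergence rates *)

Unset Implicit Arguments.

Theorem corollary5 (R : realType) (E : normedModType R)
    (n : nat) (finE : Vector.axiom n E)
    (C : set E) (C0 : C !=set0) (clC : closed C) (cvxC : convex_set C)
    (f : E -> R) (L : R) (L_gt0 : 0 < L) (smooth_f : smooth_convex L f)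
    (phi : E -> R) (sigma : R) (sigma_gt0 : 0 < sigma)
    (lsc_phi : lower_semicontinuous (extend C phi))
    (sc_phi : strongly_convex sigma C phi)
    (xstar : E) (xstar_min : argmin C f xstar)
    (s : R) (s_gt0 : 0 < s)
    (x y z : nat -> E)
    (x0_min : argmin C phi (x 0%N))
    (xyzC : forall k, [/\ C (x k), C (y k.+1) & C (z k.+1)])
    (y_min : forall k,
      argmin C (fun v => s * 'd f (x k) (v - x k) + 2^-1 * `|v - x k| ^+ 2)
        (y k.+1))
    (z_min : forall k,
      argmin C (fun v => (sigma * s)^-1 * phi v +
          \sum_(0 <= i < k.+1)
            i.+1%:R / 2 * (f (x i) + 'd f (x i) (v - x i)))
        (z k.+1))
    (x_step : forall k, x k.+1 =
      (2 / (k + 3)%:R) *: z k.+1 + (k.+1%:R / (k + 3)%:R) *: y k.+1) :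
  s <= L^-1 ->
  (forall k, (1 <= k)%N ->
    f (y k) - f xstar <=
      4 * bregman phi \0 xstar (x 0%N) / (k%:R * k.+1%:R * sigma * s)) /\
  (s < L^-1 ->
    (fun k : nat => \big[Num.min/`|y 1%N - x 0%N| ^+ 2]_(0 <= i < k.+1)
                      `|y i.+1 - x i| ^+ 2)
      =o_\oo (fun k : nat => (k%:R ^+ 3)^-1 : R)).
Proof.
move=> sL.
have Ls : L <= s^-1 by rewrite -[L]invrK lef_pV2 ?posrE ?invr_gt0.
have [Cxs xs_min] := xstar_min.
have energy k := accelerated_energy cvxC smooth_f sigma_gt0 sc_phi s_gt0
  x0_min xyzC y_min z_min x_step k Cxs.
split=> [k k1|sL'].
  have sum_ge0 : 0 <= \sum_(0 <= i < k) i.+1%:R * i.+2%:R / 4 *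
      ((s^-1 - L) / 2) * `|y i.+1 - x i| ^+ 2.
    apply: sumr_ge0 => i _; rewrite !mulr_ge0 ?invr_ge0 ?subr_ge0//.
  have kk : 0 < k%:R * k.+1%:R :> R by rewrite mulr_gt0 ?ltr0n.
  rewrite bregman0 ler_pdivlMr ?mulr_gt0 ?ltr0n//.
  have ss : 0 < sigma * s by rewrite mulr_gt0.
  have := ler_wpM2l (ltW ss) (energy k); rewrite [leRHS]mulrDr mulVKf ?gt_eqF//.
  have := mulr_ge0 (ltW ss) sum_ge0.
  rewrite [sigma * s * (_ + _)]mulrDr -[_ * _ * sigma * s]mulrA; lra.
(* The 8 is 4 times 2, from the energy coefficients, after (i+1)(i+2) is bounded below by
   (i+1)^2. *)
have sL_gt0 : 0 < (s^-1 - L) / 8.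
  by rewrite divr_gt0// subr_gt0 -[L]invrK ltf_pV2 ?posrE ?invr_gt0.
apply: (@min_littleo_cube R (fun i => `|y i.+1 - x i| ^+ 2)
  (((s^-1 - L) / 8)^-1 * ((sigma * s)^-1 * (phi xstar - phi (x 0%N))))).
  by move=> i; rewrite exprn_ge0.
move=> k; rewrite ler_pdivlMl// mulr_sumr.
(* At k = 0 the point [y 0] need not lie in [C], but its coefficient vanishes. *)
have f_ge : k%:R * k.+1%:R / 4 * f xstar <= k%:R * k.+1%:R / 4 * f (y k).
  case: k => [|k]; first by rewrite !mul0r.
  have [_ Cy _] := xyzC k.
  by rewrite ler_wpM2l ?xs_min// divr_ge0// mulr_ge0.
have : \sum_(0 <= i < k) (s^-1 - L) / 8 * (i.+1%:R ^+ 2 * `|y i.+1 - x i| ^+ 2)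
    <= \sum_(0 <= i < k) i.+1%:R * i.+2%:R / 4 * ((s^-1 - L) / 2) *
      `|y i.+1 - x i| ^+ 2.
  apply: ler_sum => i _; rewrite [leLHS]mulrA ler_wpM2r ?exprn_ge0//.
  have : (i.+1%:R ^+ 2 : R) <= i.+1%:R * i.+2%:R.
    by rewrite expr2 ler_wpM2l// ler_nat.
  move/(ler_wpM2l (ltW sL_gt0)); lra.
have := energy k; lra.
Qed.
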